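(* For every positive integer $d$ there is a constant $k_d$ depending only on $d$ such that the following holds. Let $\mathbf{F}=(F_1,\ldots,F_d)$ be a vector of $d$ finite simple graphs, each with at most $e$ edges. If $\varepsilon > 0$ and $n> 2^{ k_d d^2e^2/\varepsilon^2}$, then \[ 0 \leq \mathrm{Vol}( P_{\mathbf{F} ; \infty}) - \mathrm{Vol}( \mathrm{conv}\, Z_{\mathbf{F};n} ) < \varepsilon, \] where $\mathrm{Vol}$ is $d$-dimensional Lebesgue measure.
   Context: $|H|$ is the number of vertices of a graph $H$. For graphs $F,G$, $t^L(F,G)$ is the number of subgraphs of $G$ (not necessarily induced) isomorphic to $F$, and $t(F,G)=t^L(F,G)/t^L(F,K_{|G|})$ if $|F|\le|G|$ and $t(F,G)=0$ otherwise, where $K_N$ is the complete graph on $N$ vertices. With $t(\mathbf{F},G)=(t(F_1,G),\ldots,t(F_d,G))$, let $P_{\mathbf{F};n}=\mathrm{conv}\{t(\mathbf{F},G)\mid G\text{ a graph on } n\text{ vertices}\}$; these are nested decreasing in $n$ for $n\ge\max_i|F_i|$, and the limit object is $P_{\mathbf{F};\infty}=\bigcap_{n\ge n_0}P_{\mathbf{F};n}$ for any $n_0\ge\max_i|F_i|$. For a graph $F$ and variables $\mathbf{x}=(x_{ij})_{i,j\in[n]}$ with $x_{ij}=x_{ji}$, let $p_{F;n}(\mathbf{x})= n^{-|F|} \sum_{\phi : V(F) \rightarrow [n]} \prod_{ij \in E(F)} x_{\phi(i)\phi(j)}$ (sum over all maps $\phi$). The curvy zonotope is $Z_{\mathbf{F};n}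 = \{ (p_{F_1;n}(\mathbf{x}), \ldots, p_{F_d;n}(\mathbf{x})) \mid \mathbf{x} \in [0,1]^{n^2},\ x_{ij}=x_{ji} \}$. *)

(* Defs.v *)
From HB Require Import structures.
From mathcomp Require Import all_boot all_order all_algebra.
From mathcomp Require Import all_classical all_reals all_analysis.
From mathcomp Require Import Rstruct.
Set Implicit Arguments. Unset Strict Implicit. Unset Printing Implicit Defensive.
Import Order.TTheory GRing.Theory Num.Theory.
Local Open Scope ring_scope.

Notation RR := Rdefinitions.R.

Record sgraph := SGraph {
  sg_n : nat;
  sg_adj : rel 'I_sg_n;
  sg_sym : symmetric sg_adj;
  sg_irr : irreflexive sg_adj }.
Arguments sg_adj : clear implicits.

Definition nedges (F : sgraph) : nat :=
  #|[set p : 'I_(sg_n F) * 'I_(sg_n F) | (p.1 < p.2)%N && sg_adj F p.1 p.2]|.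

(* A subgraph (S, E) of the graph (V, adj): S a vertex subset, E a set of
   edges (2-element sets {i,j} with adj i j) inside S.  It is a copy of F if
   there is a bijection from V(F) onto S mapping the edges of F exactly onto E. *)
Definition is_copy (F : sgraph) (V : finType) (adj : rel V)
    (p : {set V} * {set {set V}}) : bool :=
  [forall E in p.2, [exists i : V, [exists j : V,
      [&& i != j, adj i j, E == [set i; j], i \in p.1 & j \in p.1]]]]
  && [exists f : {ffun 'I_(sg_n F) -> V},
      [&& injectiveb f, p.1 == f @: [set: 'I_(sg_n F)] &
          [forall i, [forall j, sg_adj F i j == ([set f i; f j] \in p.2)]]]].

Definition tL (F : sgraph) (V : finType) (adj : rel V) : nat :=
  #|[set p : {set V} * {set {set V}} | is_copy F adj p]|.

Definition Kadj (N : nat) : rel 'I_N := fun i j => i != j.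
Arguments Kadj : clear implicits.

Definition tdens (F : sgraph) (N : nat) (adj : rel 'I_N) : RR :=
  if (sg_n F <= N)%N then (tL F adj)%:R / (tL F (Kadj N))%:R else 0.

Definition tvec (d : nat) (Fs : 'I_d -> sgraph) (N : nat) (adj : rel 'I_N)
  : 'rV[RR]_d := \row_i tdens (Fs i) adj.

Local Open Scope classical_set_scope.

Definition chull (d : nat) (A : set 'rV[RR]_d) : set 'rV[RR]_d :=
  [set x | exists m (w : 'I_m -> RR) (q : 'I_m -> 'rV[RR]_d),
     [/\ forall i, 0 <= w i, \sum_(i < m) w i = 1,
         forall i, A (q i) & x = \sum_(i < m) w i *: q i]].

Definition Ppoly (d : nat) (Fs : 'I_d -> sgraph) (n : nat) : set 'rV[RR]_d :=
  chull [set tvec Fs adj | adj in [set adj : rel 'I_n | symmetric adj /\ irreflexive adj]].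

Definition Pinf (d : nat) (Fs : 'I_d -> sgraph) : set 'rV[RR]_d :=
  \bigcap_(n in [set n : nat | (\max_(i < d) sg_n (Fs i) <= n)%N]) Ppoly Fs n.

Definition pF (F : sgraph) (n : nat) (x : 'M[RR]_n) : RR :=
  (n%:R ^- sg_n F) *
  \sum_(phi : {ffun 'I_(sg_n F) -> 'I_n})
     \prod_(e : 'I_(sg_n F) * 'I_(sg_n F) | (e.1 < e.2)%N && sg_adj F e.1 e.2)
        x (phi e.1) (phi e.2).

Definition Zcurvy (d : nat) (Fs : 'I_d -> sgraph) (n : nat) : set 'rV[RR]_d :=
  [set \row_i pF (Fs i) x | x in
     [set x : 'M[RR]_n | x^T = x /\ forall i j, 0 <= x i j <= 1]].

(* d-dimensional Lebesgue (outer) measure: infimum of total volumes of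
   countable covers by closed boxes [a_k, b_k]. *)
Definition box (d : nat) (a b : 'rV[RR]_d) : set 'rV[RR]_d :=
  [set x | forall i, a 0 i <= x 0 i <= b 0 i].

Definition vol (d : nat) (A : set 'rV[RR]_d) : \bar RR :=
  ereal_inf [set s : \bar RR | exists a b : nat -> 'rV[RR]_d,
    [/\ forall k i, a k 0 i <= b k 0 i,
        A `<=` \bigcup_k box (a k) (b k) &
        s = (\sum_(0 <= k <oo) (\prod_(i < d) (b k 0 i - a k 0 i))%:E)%E]].

(* Main.v *)
(* Sampling compares the two bodies in both directions.  For a weighted graph x
   on [n], the graph on N vertices obtained from N independent uniform points of
   [n] and independent edges has expected F-density exactly p_{F;n}(x), so
   conv Z is contained in every P_{F;N}.  Conversely, for a graph G on N
   vertices and a uniform map psi : [n] -> [N], the expectation of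
   p_{F;n}(G o psi) differs from p_{F;N}(G) at most by the probability that a
   uniform map V(F) -> [n] identifies two of the at most 2e non-isolated
   vertices of F, that is by 4e^2/n; and p_{F;N}(G) tends to t(F,G) as N grows.
   Hence P_{F;oo} lies in the sup-norm r-neighbourhood of the polytope
   conv {p(B) : B a 0/1 matrix} inside conv Z, for every r > 4e^2/n; this is far
   better than the exponential bound requires, and no regularity lemma is needed.
   Finally, thickening a convex compact set in the unit cube by r adds volume
   O_d(r): each coordinate direction is treated separately, every line in that
   direction meets the set in an interval, and volumes are compared with the
   numbers of points of a fine grid. *)
Require Import Defs.
From HB Require Import structures.
From mathcomp Require Import all_boot all_order all_algebra.
From mathcomp Require Import all_classical all_reals all_analysis.
From mathcomp Require Import Rstruct Rstruct_topology lra.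
Import Order.TTheory GRing.Theory Num.Theory.
Import numFieldNormedType.Exports.
Local Open Scope ring_scope.
Set Implicit Arguments. Unset Strict Implicit. Unset Printing Implicit Defensive.

(** * Averages over uniform random maps *)

Definition avg (R : realFieldType) (T : finType) (h : T -> R) : R :=
  (\sum_t h t) / #|T|%:R.

Section average.
Variable R : realFieldType.

Lemma avg_ge0 (T : finType) (h : T -> R) : (forall t, 0 <= h t) -> 0 <= avg h.
Proof. by move=> h0; rewrite divr_ge0// sumr_ge0. Qed.

Lemma avg_exchange (S T : finType) (h : S -> T -> R) :
  avg (fun s => avg (h s)) = avg (fun t => avg (h^~ t)).
Proof. by rewrite /avg -!mulr_suml exchange_big /= mulrAC. Qed.

Lemma avg_cst (T : finType) (c : R) : (0 < #|T|)%N -> avg (fun _ : T => c) = c.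
Proof.
move=> T0; rewrite /avg sumr_const -[c *+ _]mulr_natr mulfK//.
by rewrite pnatr_eq0 -lt0n.
Qed.

(** A uniform map composed with an injection is again uniform: every fibre of psi |-> psi o f has
    the same size [c], the number of ways to choose psi freely off the image of [f]. *)
Lemma avg_restrict (V W T : finType) (f : V -> W) (h : {ffun V -> T} -> R) :
  (0 < #|T|)%N -> injective f ->
  avg (fun psi : {ffun W -> T} => h [ffun v => psi (f v)]) = avg h.
Proof.
move=> T0 finj.
pose c := (#|T| ^ #|[predC codom f]|)%N.
have fib (phi : {ffun V -> T}) :
    #|[pred psi : {ffun W -> T} | [ffun v => psi (f v)] == phi]| = c.
  (* The fibre is a product of coordinate sets: one prescribed value at each point of the image of
     [f], all of [T] elsewhere. *)
  pose F y := [pred t | [forall v, (f v == y) ==> (t == phi v)]].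
  transitivity #|family F|.
    apply: eq_card => psi; apply/eqP/familyP => [E y|H].
      by apply/forallP => v; apply/implyP => /eqP <-; rewrite -E ffunE.
    apply/ffunP => v; rewrite ffunE; have /forallP/(_ v) := H (f v).
    by rewrite eqxx => /eqP.
  rewrite card_family foldrE big_map big_enum /=.
  rewrite (bigID (mem (codom f))) /= big1 ?mul1n; last first.
    move=> _ /codomP[v ->]; apply: (fintype.eq_card1 (x := phi v)) => t.
    apply/forallP/eqP => [/(_ v)|-> u]; first by rewrite eqxx => /eqP.
    by apply/implyP => /eqP/finj ->.
  rewrite /c -prod_nat_const; apply: eq_bigr => y yf; apply: eq_card => t.
  rewrite !inE; apply/forallP => v; apply/implyP => /eqP fv.
  by rewrite -fv codom_f in yf.
rewrite /avg (partition_big (fun psi : {ffun W -> T} => [ffun v => psi (f v)])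
  predT) //=.
transitivity ((\sum_phi h phi) * c%:R / #|{ffun W -> T}|%:R).
  congr (_ / _); rewrite mulr_suml; apply: eq_bigr => phi _.
  rewrite (eq_bigr (fun=> h phi)) => [|psi /eqP -> //].
  by rewrite sumr_const fib mulr_natr.
rewrite -mulrA; congr (_ * _); rewrite !card_ffun.
have -> : #|W| = (#|[predC codom f]| + #|V|)%N.
  by rewrite -(cardC (mem (codom f))) card_codom// addnC.
rewrite expnD natrM invfM mulVKf//.
by rewrite pnatr_eq0 -lt0n expn_gt0 T0.
Qed.

(** By [avg_restrict] along the two-point injection [f], it suffices to count the |T| constant maps
    among the |T|^2 maps from [bool] to [T]. *)
Lemma avg_collision (V T : finType) (u v : V) : u != v -> (0 < #|T|)%N ->
  avg (fun phi : {ffun V -> T} => (phi u == phi v)%:R) = #|T|%:R^-1 :> R.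
Proof.
move=> uv T0; pose f b := if b then u else v.
have finj : injective f.
  by move=> [] [] //= E; move: uv; rewrite E eqxx.
have := avg_restrict (fun chi : {ffun bool -> T} => (chi true == chi false)%:R)
  T0 finj.
rewrite [LHS](_ : _ = avg (fun phi : {ffun V -> T} => (phi u == phi v)%:R)).
  move=> ->; rewrite /avg -natr_sum -big_mkcond sum1_card card_ffun card_bool.
  have -> : #|[pred chi : {ffun bool -> T} | chi true == chi false]| = #|T|.
    have ci : injective (fun t : T => [ffun=> t] : {ffun bool -> T}).
      by move=> s t /ffunP/(_ true); rewrite !ffunE.
    rewrite -(card_codom ci); apply: eq_card => chi; rewrite inE.
    apply/eqP/codomP => [E|[t ->]]; last by rewrite !ffunE.
    by exists (chi true); apply/ffunP => -[]; rewrite ffunE.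
  rewrite natrX expr2 invfM mulVKf// pnatr_eq0 -lt0n//.
by congr (_ / _); apply: eq_bigr => phi _; rewrite !ffunE.
Qed.

Definition inj_on (V T : finType) (S : {set V}) (phi : {ffun V -> T}) :=
  [forall u in S, forall v in S, (phi u == phi v) ==> (u == v)].

(** Union bound over ordered pairs of distinct elements of [S], each colliding with probability
    1/|T|. *)
Lemma avg_not_inj_on (V T : finType) (S : {set V}) : (0 < #|T|)%N ->
  avg (fun phi : {ffun V -> T} => (~~ inj_on S phi)%:R)
    <= (#|S| ^ 2)%:R / #|T|%:R :> R.
Proof.
move=> T0.
apply: (@le_trans _ _ (avg (fun phi : {ffun V -> T} =>
    \sum_(u in S) \sum_(v in S | u != v) (phi u == phi v)%:R))).
  rewrite ler_pM2r ?invr_gt0 ?ltr0n ?card_ffun ?expn_gt0 ?T0//.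
  apply: ler_sum => phi _; case: (boolP (inj_on S phi)) => /=.
    by move=> _; do 2! (apply: sumr_ge0 => ? _).
  rewrite negb_forall_in => /exists_inP[u uS]; rewrite negb_forall_in.
  move=> /exists_inP[v vS]; rewrite negb_imply => /andP[E uv].
  rewrite (bigD1 u)//= (bigD1 v) ?vS//= E -addrA lerDl addr_ge0//.
    exact: sumr_ge0.
  by do 2! (apply: sumr_ge0 => ? _).
rewrite /avg exchange_big /= mulr_suml.
apply: (@le_trans _ _ (\sum_(u in S) #|S|%:R / #|T|%:R)); last first.
  by rewrite sumr_const -[_ *+ _]mulr_natl mulrA -natrM mulnn.
apply: ler_sum => u uS; rewrite exchange_big /= mulr_suml.
apply: (@le_trans _ _ (\sum_(v in S | u != v) #|T|%:R^-1)).
  by apply: ler_sum => v /andP[_ uv]; rewrite -(avg_collision uv T0).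
rewrite big_mkcondr /=.
apply: (@le_trans _ _ (\sum_(v in S) #|T|%:R^-1)).
  by apply: ler_sum => v _; case: ifP; rewrite ?invr_ge0.
by rewrite sumr_const mulr_natl.
Qed.

(** With [th] the probability of [P], [a] the conditional mean and [b] the contribution of the
    complement, the mean is a th + b with 0 <= b <= 1 - th, so a - avg h = a (1 - th) - b lies
    between -(1 - th) and 1 - th. *)
Lemma dist_cond_avg (T : finType) (P : pred T) (h : T -> R) :
  (0 < #|P|)%N -> (forall t, 0 <= h t <= 1) ->
  `|(\sum_(t | P t) h t) / #|P|%:R - avg h| <= avg (fun t => (~~ P t)%:R).
Proof.
move=> P0 h01.
have T0 : (0 < #|T|)%N by exact: leq_trans P0 (max_card _).
have p0 : 0 < #|P|%:R :> R by rewrite ltr0n.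
have t0 : 0 < #|T|%:R :> R by rewrite ltr0n.
have -> : avg (fun t => (~~ P t)%:R) = 1 - #|P|%:R / #|T|%:R :> R.
  rewrite -[X in X - _](avg_cst (T := T) 1 T0) /avg -mulrBl; congr (_ / _).
  rewrite -sum1_card natr_sum [X in _ - X]big_mkcond -sumrB; apply: eq_bigr => t _.
  by rewrite unfold_in; case: (P t); rewrite ?subrr ?subr0.
have HE : avg h = (\sum_(t | P t) h t) / #|P|%:R * (#|P|%:R / #|T|%:R) +
    (\sum_(t | ~~ P t) h t) / #|T|%:R.
  by rewrite mulrA divfK ?lt0r_neq0// -mulrDl /avg (bigID P).
set a := (\sum_(t | P t) h t) / #|P|%:R in HE *.
set th := #|P|%:R / #|T|%:R in HE *.
set b := (\sum_(t | ~~ P t) h t) / #|T|%:R in HE.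
have a0 : 0 <= a by rewrite divr_ge0// sumr_ge0// => t _; case/andP: (h01 t).
have a1 : a <= 1.
  rewrite ler_pdivrMr// mul1r -sum1_card natr_sum; apply: ler_sum => t _.
  by case/andP: (h01 t).
have b0 : 0 <= b by rewrite divr_ge0// sumr_ge0// => t _; case/andP: (h01 t).
have b1 : b <= 1 - th.
  have -> : 1 - th = (\sum_(t | ~~ P t) 1) / #|T|%:R.
    rewrite /th -[X in X - _](@divff _ (#|T|%:R : R)) ?lt0r_neq0// -mulrBl.
    congr (_ / _); rewrite -[in LHS](cardC P) natrD addrC addKr.
    by rewrite sumr_const.
  rewrite ler_pM2r ?invr_gt0//; apply: ler_sum => t _.
  by case/andP: (h01 t).
have th0 : 0 <= th by rewrite divr_ge0.
have th1 : 0 <= 1 - th by exact: le_trans b1.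
rewrite HE ler_norml; apply/andP; split; nra.
Qed.

End average.

(** * Copies of a graph and injective homomorphisms *)

Section copies.
Variables (F : sgraph) (V : finType).
Implicit Types (adj : rel V) (f : {ffun 'I_(sg_n F) -> V}).
Local Open Scope set_scope.

Definition is_hom adj f := [forall i, forall j, sg_adj F i j ==> adj (f i) (f j)].

Definition copy_of f : {set V} * {set {set V}} :=
  (f @: [set: 'I_(sg_n F)],
   [set [set f e.1; f e.2] | e : 'I_(sg_n F) * 'I_(sg_n F) & sg_adj F e.1 e.2]).

Definition sgraph_aut : {set {ffun 'I_(sg_n F) -> 'I_(sg_n F)}} :=
  [set s : {ffun 'I_(sg_n F) -> 'I_(sg_n F)} | injectiveb s &
    [forall i, forall j, sg_adj F i j == sg_adj F (s i) (s j)]].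

Lemma set2_inj (T : finType) (a b c d : T) : [set a; b] = [set c; d] ->
  (a = c /\ b = d) \/ (a = d /\ b = c).
Proof.
move=> E.
have : a \in [set c; d] by rewrite -E set21.
have : b \in [set c; d] by rewrite -E set22.
have : c \in [set a; b] by rewrite E set21.
have : d \in [set a; b] by rewrite E set22.
rewrite !inE.
do 4 (case/orP => /eqP ?); subst; auto.
Qed.

Lemma mem_copy_of f i j : injective f ->
  ([set f i; f j] \in (copy_of f).2) = sg_adj F i j.
Proof.
move=> finj; apply/imsetP/idP => [[[u v]]|ij].
  rewrite inE /= => uv /set2_inj[[/finj -> /finj ->]|[/finj -> /finj ->]] //.
  by rewrite sg_sym.
by exists (i, j) => //; rewrite inE.
Qed.

(** The equivalence inside [is_copy] speaks only about pairs in the image of [f]; its first clause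
    forces every member of the edge set to be such a pair, so the edge set is exactly the image of
    the edges of [F]. *)
Lemma is_copyP adj (p : {set V} * {set {set V}}) : symmetric adj ->
  reflect (exists f, [/\ injective f, is_hom adj f & p = copy_of f]) (is_copy F adj p).
Proof.
move=> asym.
apply: (iffP andP) => [[/forallP edges /existsP[f /and3P[/injectiveP finj /eqP p1 /forallP p2]]]|].
  have {}p2 i j : sg_adj F i j = ([set f i; f j] \in p.2).
    by have /forallP/(_ j)/eqP := p2 i.
  have edgeP E : E \in p.2 -> exists i j, adj (f i) (f j) /\ E = [set f i; f j].
    move=> Ep; have /implyP/(_ Ep)/existsP[a /existsP[b]] := edges E.
    rewrite p1; case/and5P=> ab adjab /eqP EE /imsetP[i _ ai] /imsetP[j _ bj].
    by exists i, j; subst a b.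
  exists f; split => //.
    apply/forallP => i; apply/forallP => j; apply/implyP; rewrite p2.
    by move=> /edgeP[u [v [uv /set2_inj[[-> ->]|[-> ->]]]]] //; rewrite asym.
  apply/eqP; rewrite [p]surjective_pairing xpair_eqE p1 eqxx /=.
  apply/eqP/setP => E; apply/idP/imsetP => [Ep|[[u v]]].
    have [i [j [_ EE]]] := edgeP E Ep; exists (i, j) => //.
    by rewrite inE /= p2 -EE.
  by rewrite inE /= p2 => ? ->.
move=> [f [finj fhom ->]]; split.
  apply/forallP => E; apply/implyP => /imsetP[[u v]]; rewrite inE /= => uv ->.
  apply/existsP; exists (f u); apply/existsP; exists (f v).
  rewrite eqxx !imset_f ?inE// !andbT (inj_eq finj).
  have /forallP/(_ u)/forallP/(_ v)/implyP/(_ uv) -> := fhom.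
  by rewrite andbT; apply: contraTneq uv => ->; rewrite sg_irr.
apply/existsP; exists f; rewrite eqxx andTb; apply/andP; split; first exact/injectiveP.
by apply/forallP => i; apply/forallP => j; rewrite mem_copy_of.
Qed.

(** The embeddings with the same copy as [f] are the f o s with s an automorphism: s exists because
    the vertex images agree, and it preserves adjacency because [mem_copy_of] reads adjacency off
    the common edge set. *)
Lemma card_copy_of_fiber adj f : injective f -> is_hom adj f ->
  #|[pred g : {ffun 'I_(sg_n F) -> V} |
     (injectiveb g && is_hom adj g) && (copy_of g == copy_of f)]| = #|sgraph_aut|.
Proof.
move=> finj fhom.
pose h (s : {ffun 'I_(sg_n F) -> 'I_(sg_n F)}) : {ffun 'I_(sg_n F) -> V} :=
  [ffun i => f (s i)].
have hinj : injective h.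
  by move=> s t /ffunP E; apply/ffunP => i; have := E i; rewrite !ffunE => /finj.
rewrite -(card_imset _ hinj); apply: eq_card => g; rewrite inE.
apply/andP/imsetP => [[/andP[/injectiveP ginj _] /eqP E]|[s]].
  have cov i : exists j, g i == f j.
    have : g i \in (copy_of f).1 by rewrite -E imset_f.
    by move=> /imsetP[j _ ->]; exists j.
  pose s : {ffun 'I_(sg_n F) -> 'I_(sg_n F)} := [ffun i => xchoose (cov i)].
  have fs i : g i = f (s i) by rewrite ffunE; apply/eqP; exact: (xchooseP (cov i)).
  exists s; last by apply/ffunP => i; rewrite ffunE.
  rewrite inE; apply/andP; split.
    by apply/injectiveP => i j ij; apply: ginj; rewrite !fs ij.
  apply/forallP => i; apply/forallP => j.
  by rewrite -(mem_copy_of i j ginj) E !fs mem_copy_of.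
rewrite inE => /andP[/injectiveP sinj /forallP aut] ->.
have {}aut i j : sg_adj F i j = sg_adj F (s i) (s j).
  by have /forallP/(_ j)/eqP := aut i.
have sbij := injF_bij sinj; have [s' sK s'K] := sbij.
split.
  apply/andP; split; first by apply/injectiveP => i j; rewrite !ffunE => /finj/sinj.
  apply/forallP => i; apply/forallP => j; rewrite !ffunE aut.
  by have /forallP/(_ (s i))/forallP/(_ (s j)) := fhom.
rewrite xpair_eqE; apply/andP; split; apply/eqP/setP => E.
  apply/imsetP/imsetP => -[i _ ->].
    by exists (s i) => //; rewrite ffunE.
  by exists (s' i) => //; rewrite ffunE s'K.
apply/imsetP/imsetP => -[[u v]]; rewrite inE /= => uv ->.
  by exists (s u, s v); rewrite ?inE /= -?aut// !ffunE.
exists (s' u, s' v); last by rewrite !ffunE !s'K.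
by rewrite inE /= aut !s'K.
Qed.

Lemma card_inj_hom adj : symmetric adj ->
  #|[pred g : {ffun 'I_(sg_n F) -> V} | injectiveb g && is_hom adj g]| =
  (tL F adj * #|sgraph_aut|)%N.
Proof.
move=> asym; rewrite -[LHS]sum1_card /tL.
rewrite (partition_big copy_of (fun p => p \in [set p | is_copy F adj p])) /=; last first.
  move=> g /andP[/injectiveP ginj ghom]; rewrite inE; apply/is_copyP => //.
  by exists g.
rewrite -sum_nat_const; apply: eq_bigr => p; rewrite inE => /is_copyP[]// f [finj fhom ->].
by rewrite sum1_card -(card_copy_of_fiber finj fhom).
Qed.

Lemma card_sgraph_aut_gt0 : (0 < #|sgraph_aut|)%N.
Proof.
apply/card_gt0P; exists [ffun i => i]; rewrite inE; apply/andP; split.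
  by apply/injectiveP => i j; rewrite !ffunE.
by apply/forallP => i; apply/forallP => j; rewrite !ffunE.
Qed.

End copies.

(** By [card_inj_hom], both numbers of copies are numbers of injective homomorphisms divided by |Aut
    F|, which cancels; into the complete graph every injective map is a homomorphism. *)
Lemma tdensE (F : sgraph) (N : nat) (adj : rel 'I_N) : symmetric adj ->
  (sg_n F <= N)%N ->
  tdens F adj = #|[pred g : {ffun 'I_(sg_n F) -> 'I_N} | injectiveb g && is_hom adj g]|%:R
    / #|[pred g : {ffun 'I_(sg_n F) -> 'I_N} | injectiveb g]|%:R.
Proof.
move=> asym FN; rewrite /tdens FN.
have -> : #|[pred g : {ffun 'I_(sg_n F) -> 'I_N} | injectiveb g]| =
   #|[pred g : {ffun 'I_(sg_n F) -> 'I_N} | injectiveb g && is_hom (Kadj N) g]|.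
  apply: eq_card => g; rewrite !inE; case: injectiveP => //= ginj; apply/esym.
  apply/forallP => i; apply/forallP => j; apply/implyP => ij.
  by rewrite /Kadj (inj_eq ginj); apply: contraTneq ij => ->; rewrite sg_irr.
rewrite !card_inj_hom//; last by move=> i j; rewrite /Kadj eq_sym.
rewrite !natrM -mulf_div divff ?mulr1//.
by rewrite pnatr_eq0 -lt0n card_sgraph_aut_gt0.
Qed.

(** * Sampling vertices *)

Definition edge_pred (F : sgraph) : pred ('I_(sg_n F) * 'I_(sg_n F)) :=
  fun e => (e.1 < e.2)%N && sg_adj F e.1 e.2.

Definition hom_weight (R : realFieldType) (F : sgraph) (T : finType) (x : T -> T -> R)
    (phi : {ffun 'I_(sg_n F) -> T}) : R :=
  \prod_(e | edge_pred e) x (phi e.1) (phi e.2).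
Arguments hom_weight {R} F {T} x phi.

Section sampling.
Variable R : realFieldType.
Implicit Type F : sgraph.

Lemma hom_weight01 F (T : finType) (x : T -> T -> R) phi :
  (forall i j, 0 <= x i j <= 1) -> 0 <= hom_weight F x phi <= 1.
Proof.
move=> x01; apply/andP; split.
  by apply: prodr_ge0 => e _; case/andP: (x01 (phi e.1) (phi e.2)).
by apply: prodr_ile1 => e _; exact: x01.
Qed.

Lemma hom_weight_bool F (T : finType) (adj : rel T) phi : symmetric adj ->
  hom_weight F (fun i j => (adj i j)%:R) phi = (is_hom adj phi)%:R :> R.
Proof.
move=> asym; case: (boolP (is_hom adj phi)) => [/forallP h|].
  rewrite /hom_weight big1// => -[i j] /andP[_ /= ij].
  by have /forallP/(_ j)/implyP/(_ ij) -> := h i.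
rewrite negb_forall => /existsP[i]; rewrite negb_forall => /existsP[j].
rewrite negb_imply => /andP[ij /negbTE nadj].
have [lt|gt|/val_inj eqij] := ltngtP i j.
- by rewrite /hom_weight (bigD1 (i, j)) ?/edge_pred /= ?lt ?ij// nadj mul0r.
- have ji : edge_pred (j, i) by rewrite /edge_pred /= gt sg_sym.
  by rewrite /hom_weight (bigD1 _ ji) /= asym nadj mul0r.
- by rewrite eqij sg_irr in ij.
Qed.

Definition nonisolated F : {set 'I_(sg_n F)} := [set i | [exists j, sg_adj F i j]].

(** Each non-isolated vertex is the smaller or the larger end of an edge counted by [nedges]. *)
Lemma card_nonisolated F : (#|nonisolated F| <= 2 * nedges F)%N.
Proof.
rewrite mul2n -addnn.
apply: leq_trans (leq_add (leq_imset_card fst _) (leq_imset_card snd _)).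
rewrite -cardsUI; apply: leq_trans (leq_addr _ _).
apply: subset_leq_card; apply/fintype.subsetP => i; rewrite !inE => /existsP[j ij].
have [lt|gt|/val_inj eqij] := ltngtP i j.
- by apply/orP; left; apply/imsetP; exists (i, j); rewrite ?inE //= lt.
- by apply/orP; right; apply/imsetP; exists (j, i); rewrite ?inE //= gt sg_sym.
- by rewrite eqij sg_irr in ij.
Qed.

Lemma hom_weight_nonisolated F (T : finType) (x : T -> T -> R)
    (phi phi' : {ffun 'I_(sg_n F) -> T}) :
  {in nonisolated F, phi =1 phi'} -> hom_weight F x phi = hom_weight F x phi'.
Proof.
move=> E; apply: eq_bigr => -[i j] /andP[_ /= ij].
rewrite !E// inE; apply/existsP; first by exists i; rewrite sg_sym.
by exists j.
Qed.

(** On the non-isolated vertices psi o phi is a uniform map to [T], and the weight sees no other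
    vertex. Letting isolated vertices collide is what yields error bounds in terms of edges instead
    of vertices. *)
Lemma avg_hom_weight_comp F (S T : finType) (x : T -> T -> R)
    (phi : {ffun 'I_(sg_n F) -> S}) :
  (0 < #|T|)%N -> inj_on (nonisolated F) phi ->
  avg (fun psi : {ffun S -> T} => hom_weight F (fun i j => x (psi i) (psi j)) phi)
  = avg (hom_weight F x).
Proof.
move=> T0 phiS; have /card_gt0P[t0 _] := T0.
pose U := {i : 'I_(sg_n F) | i \in nonisolated F}.
(* The weight depends only on the non-isolated vertices, on which [phi] is
   injective; [ext] fills in the isolated ones with an arbitrary value. *)
pose ext (chi : {ffun U -> T}) : {ffun 'I_(sg_n F) -> T} :=
  [ffun i => if insub i is Some u then chi u else t0].
have finj : injective (fun u : U => phi (val u)).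
  move=> u v /eqP E; apply: val_inj; apply/eqP.
  have /forall_inP/(_ (val u) (valP u))/forall_inP/(_ (val v) (valP v)) := phiS.
  by rewrite E.
have extE (psi : {ffun 'I_(sg_n F) -> T}) :
    hom_weight F x psi = hom_weight F x (ext [ffun u => psi (val u)]).
  apply: hom_weight_nonisolated => i iS; rewrite ffunE insubT /=.
  by rewrite ffunE.
transitivity (avg (fun chi => hom_weight F x (ext chi))).
  rewrite -(avg_restrict _ T0 finj) /avg; congr (_ / _).
  apply: eq_bigr => psi _.
  transitivity (hom_weight F x [ffun i => psi (phi i)]).
    by apply: eq_bigr => e _; rewrite !ffunE.
  rewrite extE; congr (hom_weight F x (ext _)).
  by apply/ffunP => u; rewrite !ffunE.
rewrite -(avg_restrict _ T0 (@val_inj _ _ U)) /avg; congr (_ / _).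
by apply: eq_bigr => psi _; rewrite -extE.
Qed.

(** After exchanging the averages, a map phi injective on the non-isolated vertices contributes no
    error, by [avg_hom_weight_comp]; any other phi contributes at most 1, and such phi have
    probability at most (2 e(F))^2 / |S|. *)
Lemma dist_avg_hom_weight_sample F (S T : finType) (x : T -> T -> R) :
  (0 < #|T|)%N -> (0 < #|S|)%N -> (forall i j, 0 <= x i j <= 1) ->
  `|avg (hom_weight F x) -
    avg (fun psi : {ffun S -> T} => avg (hom_weight F (fun i j => x (psi i) (psi j))))|
  <= ((2 * nedges F) ^ 2)%:R / #|S|%:R.
Proof.
move=> T0 S0 x01; rewrite avg_exchange.
have F0 : (0 < #|{ffun 'I_(sg_n F) -> S}|)%N by rewrite card_ffun expn_gt0 S0.
have P0 : (0 < #|{ffun S -> T}|)%N by rewrite card_ffun expn_gt0 T0.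
have avg01 (I : finType) (h : I -> R) : (0 < #|I|)%N ->
    (forall i, 0 <= h i <= 1) -> 0 <= avg h <= 1.
  move=> I0 h01; rewrite avg_ge0 => [|i]; last by case/andP: (h01 i).
  rewrite /avg ler_pdivrMr ?ltr0n// mul1r -sum1_card natr_sum.
  by apply: ler_sum => i _; case/andP: (h01 i).
apply: (@le_trans _ _ (avg (fun phi : {ffun 'I_(sg_n F) -> S} =>
    (~~ inj_on (nonisolated F) phi)%:R))); last first.
  apply: le_trans (avg_not_inj_on _ _ S0) _.
  rewrite ler_pM2r ?invr_gt0 ?ltr0n// ler_nat leq_exp2r//.
  exact: card_nonisolated.
rewrite -[X in `|X - _|](avg_cst _ F0) /avg -mulrBl -sumrB normrM.
rewrite [`|_^-1|]ger0_norm ?invr_ge0// ler_pM2r ?invr_gt0 ?ltr0n//.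
apply: le_trans (ler_norm_sum _ _ _) _; apply: ler_sum => phi _.
case: (boolP (inj_on _ phi)) => [h|_] /=.
  by rewrite -/(avg _) -/(avg _) avg_hom_weight_comp// subrr normr0.
have /andP[a0 a1] : 0 <= avg (hom_weight F x) <= 1.
  apply: avg01; first by rewrite card_ffun expn_gt0 T0.
  by move=> psi; exact: hom_weight01.
have /andP[b0 b1] : 0 <= avg (fun psi : {ffun S -> T} =>
    hom_weight F (fun i j => x (psi i) (psi j)) phi) <= 1.
  by apply: avg01 => // psi; exact: hom_weight01.
rewrite -/(avg _) -/(avg _).
by rewrite ler_norml; apply/andP; split; lra.
Qed.

End sampling.

Lemma tdens_avgE (F : sgraph) (N : nat) (adj : rel 'I_N) : symmetric adj ->
  (sg_n F <= N)%N ->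
  tdens F adj =
    (\sum_(g : {ffun 'I_(sg_n F) -> 'I_N} | injectiveb g)
       hom_weight F (fun i j => (adj i j)%:R) g)
    / #|[pred g : {ffun 'I_(sg_n F) -> 'I_N} | injectiveb g]|%:R.
Proof.
move=> asym FN; rewrite tdensE//; congr (_ / _).
rewrite -sum1_card natr_sum (eq_bigl (fun g : {ffun 'I_(sg_n F) -> 'I_N} =>
  injectiveb g && is_hom adj g)) //.
by rewrite big_mkcondr /=; apply: eq_bigr => g _; rewrite hom_weight_bool//; case: ifP.
Qed.

Lemma card_injectiveb_gt0 (k N : nat) : (k <= N)%N ->
  (0 < #|[pred g : {ffun 'I_k -> 'I_N} | injectiveb g]|)%N.
Proof.
move=> kN; apply/card_gt0P; exists [ffun i => widen_ord kN i].
by apply/injectiveP => i j; rewrite !ffunE => /(congr1 val) /= /val_inj.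
Qed.

(** The density is the mean weight conditioned on injectivity, so [dist_cond_avg] bounds the error
    by the probability of a collision. The bound involves |F|, which is harmless because N later
    tends to infinity. *)
Lemma dist_tdens_avg (F : sgraph) (N : nat) (adj : rel 'I_N) : symmetric adj ->
  (0 < N)%N -> (sg_n F <= N)%N ->
  `|tdens F adj - avg (hom_weight F (fun i j => (adj i j)%:R))|
  <= (sg_n F ^ 2)%:R / N%:R :> RR.
Proof.
move=> asym N0 FN; rewrite tdens_avgE//.
apply: le_trans (dist_cond_avg _ _) _.
- exact: card_injectiveb_gt0.
- by move=> phi; apply: hom_weight01 => i j; case: (adj i j); rewrite ?lexx ?ler01.
have := @avg_not_inj_on RR 'I_(sg_n F) 'I_N [set: _]%SET; rewrite !card_ord cardsT card_ord.
move=> /(_ N0); apply: le_trans.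
rewrite /avg ler_pM2r ?invr_gt0 ?ltr0n ?card_ffun ?card_ord ?expn_gt0 ?N0//.
apply: ler_sum => phi _; case: injectiveP => //= ninj.
case: (boolP (inj_on _ _)) => //= /forall_inP h; exfalso; apply: ninj => u v E.
by have /forall_inP/(_ v) := h u (finset.in_setT _); rewrite finset.in_setT E eqxx => /(_ isT)/eqP.
Qed.

Lemma pFE (F : sgraph) (n : nat) (x : 'M[RR]_n) :
  pF F x = avg (hom_weight F (fun i j => x i j)).
Proof. by rewrite /pF /avg card_ffun !card_ord natrX mulrC. Qed.

(** * Random graphs sampled from a weighted graph *)

Section random_graph.
Variable N : nat.
Implicit Types (G : {ffun 'I_N * 'I_N -> bool}) (i j : 'I_N).

(** A random graph is encoded by independent bits at all N^2 ordered pairs; [graph_rel] reads only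
    the bit at the increasing pair. The other bits are dummies that make the total weight a full
    product. *)
Definition ordered_pair i j := if (i < j)%N then (i, j) else (j, i).

Definition graph_rel G : rel 'I_N := fun i j => (i != j) && G (ordered_pair i j).

Lemma ordered_pairC i j : ordered_pair i j = ordered_pair j i.
Proof. by rewrite /ordered_pair; case: ltngtP => // /val_inj ->. Qed.

Lemma graph_rel_sym G : symmetric (graph_rel G).
Proof. by move=> i j; rewrite /graph_rel eq_sym ordered_pairC. Qed.

Lemma graph_rel_irr G : irreflexive (graph_rel G).
Proof. by move=> i; rewrite /graph_rel eqxx. Qed.

(** The probability of [G] when the bit at each pair is drawn independently with success probability
    given by [y]. *)
Definition graph_weight (y : 'I_N -> 'I_N -> RR) G : RR :=
  \prod_p (if G p then y p.1 p.2 else 1 - y p.1 p.2).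

Lemma graph_weight_ge0 y G : (forall i j, 0 <= y i j <= 1) -> 0 <= graph_weight y G.
Proof.
move=> y01; apply: prodr_ge0 => p _; have /andP[y0 y1] := y01 p.1 p.2.
by case: ifP; rewrite ?subr_ge0.
Qed.

Lemma sum_graph_weight y : \sum_G graph_weight y G = 1.
Proof.
rewrite -(bigA_distr_bigA (fun p (b : bool) => if b then y p.1 p.2 else 1 - y p.1 p.2)).
by rewrite big1// => p _; rewrite big_bool /= addrC subrK.
Qed.

Lemma sum_graph_weight_hom (F : sgraph) y (f : {ffun 'I_(sg_n F) -> 'I_N}) :
  (forall i j, y i j = y j i) -> injective f ->
  \sum_G graph_weight y G * hom_weight F (fun i j => (graph_rel G i j)%:R) f =
  hom_weight F y f.
Proof.
move=> ysym finj.
pose o (e : 'I_(sg_n F) * 'I_(sg_n F)) := ordered_pair (f e.1) (f e.2).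
have oinj : {in [pred e | edge_pred e] &, injective o}.
  move=> [i j] [u v]; rewrite !inE => /andP[/= ij _] /andP[/= uv _].
  rewrite /o /ordered_pair /=.
  by case: ifP => _; case: ifP => _ [/finj E1 /finj E2]; subst => //;
    have := ltn_trans ij uv; rewrite ltnn.
(* The edges of [F] land on distinct potential edges [Im]; the remaining
   coordinates of [G] contribute a factor [y + (1 - y) = 1] each. *)
pose Im := [set o e | e in [pred e | edge_pred e]]%SET.
transitivity (\sum_(G : {ffun 'I_N * 'I_N -> bool}) \prod_p
    ((if G p then y p.1 p.2 else 1 - y p.1 p.2) *
    (if p \in Im then (G p)%:R else 1))).
  apply: eq_bigr => G _; rewrite big_split /=; congr (_ * _).
  rewrite -big_mkcond /= (big_imset _ oinj) /=.
  apply: eq_bigr => -[i j] /andP[/= ij _].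
  rewrite /graph_rel (inj_eq finj) /o /=; case: eqP ij => [->|//].
  by rewrite ltnn.
rewrite -(bigA_distr_bigA (fun p (b : bool) =>
   (if b then y p.1 p.2 else 1 - y p.1 p.2) * (if p \in Im then b%:R else 1))).
transitivity (\prod_(p in Im) y p.1 p.2).
  rewrite [RHS]big_mkcond; apply: eq_bigr => p _; rewrite big_bool /=.
  by case: ifP => _; rewrite !mulr1 ?mulr0 ?addr0// addrC subrK.
rewrite (big_imset _ oinj) /=; apply: eq_bigr => e _.
by rewrite /o /ordered_pair; case: ifP => _ //=; rewrite ysym.
Qed.

(** The identity is exact because the density averages over injective maps g only: for each of them,
    averaging over the edges gives the weight of g by [sum_graph_weight_hom], and averaging over the
    vertices gives the full mean by [avg_hom_weight_comp]. *)
Lemma avg_tdens_sample (F : sgraph) (T : finType) (x : T -> T -> RR) :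
  (0 < #|T|)%N -> (sg_n F <= N)%N -> (forall a b, x a b = x b a) ->
  avg (fun psi : {ffun 'I_N -> T} =>
    \sum_G graph_weight (fun i j => x (psi i) (psi j)) G * tdens F (graph_rel G))
  = avg (hom_weight F x).
Proof.
move=> T0 FN xsym.
pose K : RR := #|[pred g : {ffun 'I_(sg_n F) -> 'I_N} | injectiveb g]|%:R.
have K0 : K != 0 by rewrite pnatr_eq0 -lt0n card_injectiveb_gt0.
transitivity (avg (fun psi : {ffun 'I_N -> T} =>
  (\sum_(g : {ffun 'I_(sg_n F) -> 'I_N} | injectiveb g)
     hom_weight F (fun i j => x (psi i) (psi j)) g) / K)).
  congr (_ / _); apply: eq_bigr => psi _.
  under eq_bigr => G _ do rewrite (tdens_avgE (graph_rel_sym G) FN).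
  under eq_bigr do rewrite mulrA.
  rewrite -mulr_suml; congr (_ / _).
  under eq_bigr do rewrite mulr_sumr.
  rewrite exchange_big; apply: eq_bigr => g /injectiveP ginj /=.
  by apply: sum_graph_weight_hom => // a b; rewrite xsym.
rewrite /avg -mulr_suml exchange_big /= mulrAC mulr_suml.
rewrite (eq_bigr (fun=> avg (hom_weight F x))) => [|g /injectiveP ginj].
  by rewrite sumr_const -[_ *+ _]mulr_natr mulfK.
rewrite -/(avg _) avg_hom_weight_comp//.
apply/forall_inP => u _; apply/forall_inP => v _; apply/implyP => /eqP/ginj ->.
exact: eqxx.
Qed.

End random_graph.

Local Open Scope classical_set_scope.

(** * Grid points and the volume of neighbourhoods of convex sets *)

(** All members lie between the least one [a] and the greatest one [b], which leaves b - a + 1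
    integers. *)
Lemma card_bounded_spread (R : realType) (m : nat) (P : pred 'I_m) (K : R) :
  0 <= K ->
  (forall c c', P c -> P c' -> (c <= c')%N -> (c' - c)%:R <= K) ->
  #|P|%:R <= K + 1.
Proof.
move=> K0 HP; case: (pickP P) => [c1 Pc1|P0]; last first.
  by rewrite (eq_card0 P0) addr_ge0.
case: (arg_minnP (fun c : 'I_m => nat_of_ord c) Pc1) => a Pa amin.
case: (arg_maxnP (fun c : 'I_m => nat_of_ord c) Pc1) => b Pb bmax.
have ab : (a <= b)%N by exact: amin.
apply: (@le_trans _ _ ((b - a)%:R + 1)); last by rewrite lerD2r HP.
rewrite natr1 ler_nat cardE -(size_map val) -(size_iota a (b - a).+1).
apply: uniq_leq_size; first by rewrite map_inj_uniq ?enum_uniq//; exact: val_inj.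
move=> k /mapP[c]; rewrite mem_enum => Pc ->; rewrite mem_iota /=.
have ac : (a <= c)%N by exact: amin.
have cb : (c <= b)%N by exact: bmax.
by rewrite addnS subnKC// ltnS ac cb.
Qed.

(* The points outside [I] but within [r] of it lie on two sides of [I]; on each
   side they are pairwise at distance at most [r]. *)
Lemma card_interval_collar (R : realType) (q m : nat) (I : set R) (r : R) :
  (0 < q)%N -> 0 <= r -> is_interval I ->
  #|[pred c : 'I_m | `[< (exists2 s, I s & `|(c%:R : R) / q%:R - s| <= r)
       /\ ~ I (c%:R / q%:R) >]]|%:R <= 2 * (r * q%:R + 1).
Proof.
move=> q0 r0 itvI.
have q0R : 0 < q%:R :> R by rewrite ltr0n.
have diff (c c' : 'I_m) : (c <= c')%N ->
    (c'%:R : R) / q%:R - c%:R / q%:R <= r -> (c' - c)%:R <= r * q%:R.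
  by move=> cc' h; rewrite natrB// -ler_pdivrMr// mulrBl.
pose up := [pred c : 'I_m | `[< (exists2 s, I s & `|(c%:R : R) / q%:R - s| <= r)
       /\ ~ I (c%:R / q%:R) >] & `[< forall s, I s -> s < c%:R / q%:R >]].
pose dn := [pred c : 'I_m | `[< (exists2 s, I s & `|(c%:R : R) / q%:R - s| <= r)
       /\ ~ I (c%:R / q%:R) >] & `[< forall s, I s -> c%:R / q%:R < s >]].
have rq0 : 0 <= r * q%:R by rewrite mulr_ge0.
have hup : #|up|%:R <= r * q%:R + 1.
  apply: card_bounded_spread => // c c' /andP[_ /asboolP cI].
  move=> /andP[/asboolP[[s Is hs] _] _] cc'.
  apply: diff => //; apply: le_trans _ hs; apply: le_trans (ler_norm _).
  by rewrite lerD2l lerN2 ltW// cI.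
have hdn : #|dn|%:R <= r * q%:R + 1.
  apply: card_bounded_spread => // c c' /andP[/asboolP[[s Is hs] _] _].
  move=> /andP[_ /asboolP cI] cc'.
  apply: diff => //; apply: le_trans _ hs; rewrite distrC.
  by apply: le_trans (ler_norm _); rewrite lerD2r ltW// cI.
apply: (@le_trans _ _ (#|up| + #|dn|)%:R); last first.
  by rewrite natrD; apply: le_trans (lerD hup hdn) _; rewrite mulr_natl mulr2n.
rewrite ler_nat -cardUI; apply: leq_trans (leq_addr _ _).
apply: subset_leq_card; apply/fintype.subsetP => c hc.
have /asboolP[[s Is hs] nI] := hc.
case: (ltP s (c%:R / q%:R)) => sc; apply/orP; [left|right]; apply/andP; split=> //;
  apply/asboolP => t It.
- rewrite ltNge; apply/negP => ct; apply: nI; apply: (itvI s t) => //.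
  by rewrite (ltW sc) ct.
- rewrite ltNge; apply/negP => ct; apply: nI; apply: (itvI t s) => //.
  by rewrite sc ct.
Qed.

Definition fupd (d m : nat) (z : {ffun 'I_d -> 'I_m}) (j : 'I_d) (c : 'I_m)
  : {ffun 'I_d -> 'I_m} := [ffun i => if i == j then c else z i].

(** Double counting through the involution exchanging [c] with the j-th coordinate of [z]: each
    point of [P] is counted once for every value of the overwritten coordinate. *)
Lemma sum_card_fupd (d m : nat) (j : 'I_d) (P : pred {ffun 'I_d -> 'I_m}) :
  (\sum_z #|[pred c | P (fupd z j c)]| = m * #|P|)%N.
Proof.
under eq_bigr do rewrite -sum1_card big_mkcond.
rewrite pair_big /=.
pose h (u : {ffun 'I_d -> 'I_m} * 'I_m) := (fupd u.1 j u.2, u.1 j).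
have hK : involutive h.
  move=> [z c]; rewrite /h /=; congr pair; last by rewrite ffunE eqxx.
  by apply/ffunP => i; rewrite !ffunE; case: eqP => // ->.
rewrite (reindex_inj (inv_inj hK)) /=.
transitivity (\sum_(u : {ffun 'I_d -> 'I_m} * 'I_m) (P u.1 : nat))%N.
  apply: eq_bigr => -[z c] _ /=; rewrite inE /=.
  have -> : fupd (fupd z j c) j (z j) = z.
    by apply/ffunP => i; rewrite !ffunE; case: eqP => // ->.
  by case: (P z).
rewrite -(pair_big predT predT (fun z (c : 'I_m) => P z : nat)) /=.
under eq_bigr do rewrite sum_nat_const card_ord.
rewrite -big_distrr /= -sum1_card [in RHS]big_mkcond; congr (_ * _)%N.
Qed.

Section grid.
Variables (R : realType) (d : nat).
Implicit Types (A B : set 'rV[R]_d) (r : R).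

Definition gridpt (q : nat) (z : {ffun 'I_d -> 'I_q.+1}) : 'rV[R]_d :=
  \row_i ((z i)%:R / q%:R).

Definition convex_rv A := forall x y (t : R), A x -> A y -> 0 <= t <= 1 ->
  A (t *: x + (1 - t) *: y).

(* Only the first [j] coordinates are thickened, so that the full neighbourhood
   (j = d) is reached from [A] (j = 0) one coordinate at a time. *)
Definition thicken A r (j : nat) : set 'rV[R]_d :=
  [set x | exists2 y, A y &
    forall i : 'I_d, `|x 0 i - y 0 i| <= if (i < j)%N then r else 0].

Definition gridcount q A := #|[pred z | `[< A (@gridpt q z) >]]|.

Lemma thicken_convex A r j : convex_rv A -> convex_rv (thicken A r j).
Proof.
move=> cA x x' t [y Ay hy] [y' Ay' hy'] t01.
exists (t *: y + (1 - t) *: y'); first exact: cA.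
move=> i; move: (hy i) (hy' i); rewrite !mxE; move: (if _ then _ else _) => c.
rewrite !ler_norml => /andP[h1 h2] /andP[h3 h4]; move/andP: t01 => [t0 t1].
by apply/andP; split; nra.
Qed.

(** The grid splits into (q+1)^(d-1) lines in direction [j]. By convexity each meets [thicken A r j]
    in an interval, and its new points lie in the collar of width [r] around that interval, so
    [card_interval_collar] applies. *)
Lemma gridcount_thickenS q A r (j : 'I_d) : (0 < q)%N -> 0 <= r -> convex_rv A ->
  (gridcount q (thicken A r j.+1))%:R <=
  (gridcount q (thicken A r j))%:R + q.+1%:R ^+ d / q.+1%:R * (2 * (r * q%:R + 1)).
Proof.
move=> q0 r0 cA.
(* Multiplying by q+1 turns each count into a sum, over all grid points z, of the count on the line
   through z. *)
have m0 : 0 < q.+1%:R :> R by rewrite ltr0n.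
rewrite -(ler_pM2l m0) mulrDr (mulrC (_ ^+ d)) -(mulrA _^-1) mulVKf ?lt0r_neq0//.
rewrite /gridcount -!natrM -!(sum_card_fupd j) mulrC.
have -> : q.+1%:R ^+ d = \sum_(z : {ffun 'I_d -> 'I_q.+1}) (1 : R).
  by rewrite sumr_const card_ffun !card_ord natrX.
rewrite mulr_sumr !natr_sum -big_split /=; apply: ler_sum => z _.
rewrite mulr1.
pose ln (s : R) : 'rV[R]_d := \row_i (if i == j then s else gridpt z 0 i).
pose I := [set s | thicken A r j (ln s)].
have lnE c : gridpt (fupd z j c) = ln (c%:R / q%:R).
  by apply/rowP => i; rewrite !mxE !ffunE; case: eqP.
have itvI : is_interval I.
  move=> s t Is It u /andP[su ut].
  have [st|st] := eqVneq s t.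
    by have -> : u = s by apply/eqP; rewrite eq_le su st ut.
  have ts : 0 < t - s by rewrite subr_gt0 lt_neqAle st (le_trans su).
  have := thicken_convex (t := (t - u) / (t - s)) cA Is It.
  set w := (t - u) / (t - s).
  rewrite /I /=; suff -> : w *: ln s + (1 - w) *: ln t = ln u.
    apply; apply/andP; split; first by rewrite divr_ge0 ?subr_ge0// ltW// -subr_gt0.
    by rewrite ler_pdivrMr// mul1r lerD2l lerN2.
  have tsN : t - s != 0 by rewrite lt0r_neq0.
  have wE : w * (t - s) = t - u by rewrite /w divfK.
  by apply/rowP => i; rewrite !mxE; case: eqP => _; lra.
have := card_interval_collar q.+1 q0 r0 itvI.
rewrite -(lerD2l #|[pred c | `[< thicken A r j (gridpt (fupd z j c)) >]]|%:R).
apply: le_trans; rewrite -natrD ler_nat -cardUI; apply: leq_trans (leq_addr _ _).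
apply: subset_leq_card; apply/fintype.subsetP => c /asboolP; rewrite lnE => -[y Ay hy].
case: (pselect (I (c%:R / q%:R))) => Ic; apply/orP; [left|right]; apply/asboolP.
  by rewrite lnE.
(* Moving the j-th coordinate to that of [y] reduces its error to 0 and leaves the others unchanged,
   so the moved point lies in [thicken A r j]. *)
split=> //; exists (y 0 j); last by have := hy j; rewrite mxE eqxx ltnSn.
exists y => // i; have := hy i; rewrite !mxE; case: eqP => [->|/eqP ij] h.
  by rewrite subrr normr0 ltnn.
apply: le_trans h _; have -> : (i < j.+1)%N = (i < j)%N; last by [].
by rewrite ltnS leq_eqVlt (inj_eq val_inj) (negbTE ij).
Qed.

(** Each of the d steps costs T = 2 (r + 1/q) (q/(q+1)) (q+1)^d; bounding q/(q+1) by 1 and q+1 by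
    2q, then dividing by q^d, gives 2^(d+1) (r + 1/q). *)
Lemma gridcount_thicken q A r : (0 < q)%N -> 0 <= r -> convex_rv A ->
  (gridcount q (thicken A r d))%:R / q%:R ^+ d <=
  (gridcount q A)%:R / q%:R ^+ d + (d * 2 ^ d.+1)%:R * (r + q%:R^-1).
Proof.
move=> q0 r0 cA.
have q0R : 0 < q%:R :> R by rewrite ltr0n.
have m0 : 0 < q.+1%:R :> R by rewrite ltr0n.
set T : R := q.+1%:R ^+ d / q.+1%:R * (2 * (r * q%:R + 1)).
have H j : (j <= d)%N -> (gridcount q (thicken A r j))%:R <=
    (gridcount q A)%:R + j%:R * T.
  elim: j => [_|j IH jd].
    rewrite mul0r addr0 ler_nat; apply: subset_leq_card.
    apply/fintype.subsetP => z /asboolP[y Ay hy]; apply/asboolP.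
    suff -> : gridpt z = y by [].
    by apply/rowP => i; apply/eqP; rewrite -subr_eq0 -normr_le0; exact: hy.
  apply: le_trans (gridcount_thickenS (Ordinal jd) q0 r0 cA) _.
  by rewrite -/T -[j.+1%:R]natr1 mulrDl mul1r addrA lerD2r; apply: IH; exact: ltnW.
have qd0 : 0 < q%:R ^+ d :> R by rewrite exprn_gt0.
rewrite ler_pdivrMr// mulrDl divfK ?lt0r_neq0//.
apply: le_trans (H d (leqnn _)) _; rewrite lerD2l natrM -!mulrA.
rewrite ler_wpM2l//.
have -> : T = (2 * (r + q%:R^-1)) * (q%:R / q.+1%:R * q.+1%:R ^+ d).
  rewrite /T; set a := q.+1%:R ^+ d; set b := q.+1%:R^-1.
  have qV : q%:R^-1 * q%:R = 1 :> R by rewrite mulVf ?lt0r_neq0.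
  have -> : 2 * (r + q%:R^-1) * (q%:R * b * a) =
     a * b * (2 * (r * q%:R + q%:R^-1 * q%:R)) by lra.
  by rewrite qV.
have -> : (2 ^ d.+1)%:R * ((r + q%:R^-1) * q%:R ^+ d)
   = 2 * (r + q%:R^-1) * (2 * q%:R) ^+ d.
  by rewrite natrX exprMn exprS; lra.
have rr : 0 <= r + q%:R^-1 by rewrite addr_ge0// invr_ge0.
rewrite ler_wpM2l// ?mulr_ge0//.
apply: (@le_trans _ _ (q.+1%:R ^+ d)).
  rewrite ler_piMl ?exprn_ge0//; last first.
  by rewrite ler_pdivrMr// mul1r ler_nat.
apply: lerXn2r; rewrite ?nnegrE ?mulr_ge0//.
by rewrite -natrM ler_nat mul2n -addnn -addn1 leq_add2l.
Qed.

End grid.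

(** * Box covers, outer measure and grid counts *)

Lemma prod_shift_lt (R : realFieldType) (d : nat) (l : 'I_d -> R) (eta : R) :
  (forall i, 0 <= l i) -> 0 < eta ->
  exists2 t, 0 < t & \prod_i (l i + t) <= \prod_i l i + eta.
Proof.
move=> l0 eta0.
have [C C0 HC] : exists2 C, 0 <= C & forall t, 0 <= t <= 1 ->
    \prod_i (l i + t) <= \prod_i l i + C * t.
  elim: (index_enum 'I_d) => [|j s [C C0 IH]].
    by exists 0 => // t _; rewrite !big_nil; lra.
  have p0 : 0 <= \prod_(i <- s) l i by exact: prodr_ge0.
  have := l0 j => lj0.
  have lC : 0 <= l j * C by rewrite mulr_ge0.
  (* With P the product over [s], (l j + t)(P + C t) <= l j P + (P + l j C + C) t because t^2 <=
     t. *)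
  exists (\prod_(i <- s) l i + l j * C + C); first by rewrite !addr_ge0.
  move=> t t01; rewrite !big_cons; have := IH t t01 => {}IH.
  move: t01 IH => /andP[t0 t1] IH.
  apply: (@le_trans _ _ ((l j + t) * (\prod_(i <- s) l i + C * t))).
    by rewrite ler_wpM2l// addr_ge0.
  by have : 0 <= C * t by [exact: mulr_ge0]; nra.
(* The added 1 keeps the denominator positive when C = 0. *)
exists (Num.min 1 (eta / (C + 1))).
  by rewrite lt_min ltr01 divr_gt0// ltr_wpDl.
set t := Num.min _ _.
have t1 : t <= 1 by rewrite ge_min lexx.
have t0 : 0 <= t by rewrite le_min ler01 divr_ge0// ?addr_ge0// ltW.
have Ct : C * t <= eta.
  apply: (@le_trans _ _ ((C + 1) * (eta / (C + 1)))).
    apply: ler_pM => //; first by rewrite lerDl.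
    by rewrite ge_min lexx orbT.
  by rewrite mulrC divfK// gt_eqF// ltr_wpDl.
by apply: le_trans (HC t _) _; [rewrite t0|rewrite lerD2l].
Qed.

(** Each axis has at most q (b_i - a_i) + 1 grid values in its interval. *)
Lemma gridcount_box (R : realType) (d q : nat) (a b : 'I_d -> R) :
  (0 < q)%N -> (forall i, a i <= b i) ->
  (gridcount q [set x : 'rV[R]_d | forall i, a i <= x 0 i <= b i])%:R / q%:R ^+ d
  <= \prod_i (b i - a i + q%:R^-1).
Proof.
move=> q0 ab; have q0R : 0 < q%:R :> R by rewrite ltr0n.
pose F i := [pred c : 'I_q.+1 | a i <= (c%:R : R) / q%:R <= b i].
apply: (@le_trans _ _ (#|family F|%:R / q%:R ^+ d)).
  rewrite ler_pM2r ?invr_gt0 ?exprn_gt0// ler_nat; apply: subset_leq_card.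
  apply/fintype.subsetP => z /asboolP hz; apply/familyP => i.
  by have := hz i; rewrite mxE.
rewrite card_family foldrE big_map big_enum /= natr_prod.
have -> : q%:R ^+ d = \prod_(i < d) (q%:R : R) by rewrite prodr_const card_ord.
rewrite -prodf_div.
apply: ler_prod => i _; rewrite divr_ge0//= ler_pdivrMr// mulrDl mulVf ?lt0r_neq0//.
apply: card_bounded_spread; first by rewrite mulr_ge0// subr_ge0.
move=> c c' /andP[h1 _] /andP[_ h2] cc'.
rewrite natrB// -ler_pdivrMr// mulrBl lerB//.
Qed.

Lemma open_rv_box (R : realType) (d : nat) (a b : 'I_d -> R) :
  open [set x : 'rV[R]_d | forall i, a i < x 0 i < b i].
Proof.
rewrite openE => x hx.
apply: (@filter_forall _ _ (fun i (y : 'rV[R]_d) => a i < y 0 i < b i) (nbhs x)) => i.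
have : nbhs (x 0 i) [set y | a i < y < b i].
  apply: open_nbhs_nbhs; split; last exact: hx.
  have -> : [set y | a i < y < b i] = [set y | y > a i] `&` [set y | y < b i].
    by apply/seteqP; split => y /=; [move=> /andP[]|move=> [-> ->]].
  by apply: openI; [exact: open_gt|exact: open_lt].
exact: (@coord_continuous _ 1 d 0 i x).
Qed.

(** Enlarge the boxes slightly to open ones and extract a finite subcover; on a fine enough grid,
    the points in each enlarged box are counted by nearly its volume. The threshold [Q] depends on
    the cover. *)
Lemma compact_cover_gridcount (R : realType) (d : nat) (A : set 'rV[R]_d)
    (a b : nat -> 'rV[R]_d) (eta : R) :
  (forall k i, a k 0 i <= b k 0 i) -> compact A ->
  A `<=` \bigcup_k [set x | forall i, a k 0 i <= x 0 i <= b k 0 i] ->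
  0 < eta ->
  exists Q : R, forall q, (0 < q)%N -> Q <= q%:R ->
  (((gridcount q A)%:R / q%:R ^+ d)%:E <=
   \sum_(0 <= k <oo) (\prod_(i < d) (b k 0 i - a k 0 i))%:E + eta%:E)%E.
Proof.
move=> ab cA Acov eta0.
have l0 k i : 0 <= b k 0 i - a k 0 i by rewrite subr_ge0.
have /choice[t ht] k : exists t : R, 0 < t /\
    \prod_(i < d) (b k 0 i - a k 0 i + t) <=
    \prod_(i < d) (b k 0 i - a k 0 i) + eta / (2 ^ k.+1)%:R.
  have [|t t0 ht] := @prod_shift_lt R d (fun i => b k 0 i - a k 0 i)
    (eta / (2 ^ k.+1)%:R) (l0 k).
    by rewrite divr_gt0// ltr0n expn_gt0.
  by exists t.
(* The allowance [t k] in each side length is split into thirds: one for each end of the interval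
   and one for the mesh 1/q. *)
pose U k := [set x : 'rV[R]_d | forall i,
  a k 0 i - t k / 3 < x 0 i < b k 0 i + t k / 3].
have t0 k : 0 < t k by have [] := ht k.
move: cA; rewrite compact_cover => /(_ _ setT U) [||D _ AD].
- by move=> k _; exact: open_rv_box.
- move=> x /Acov[k _ hx]; exists k => // i.
  have /andP[h1 h2] : a k 0 i <= x 0 i <= b k 0 i by exact: hx.
  by have tk := t0 k; apply/andP; split; lra.
pose N := (\max_(k <- finmap.enum_fset D) k).+1.
have DN k : k \in finmap.enum_fset D -> (k < N)%N.
  by move=> kD; rewrite ltnS (big_rem k) ?leq_maxl.
(* The sum dominates each 3 / t k with k < N, so that the mesh is at most t k / 3 for all these
   k. *)
exists (\sum_(k < N) 3 / t k) => q q0 Qq.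
have q0R : 0 < q%:R :> R by rewrite ltr0n.
have qt k : (k < N)%N -> q%:R^-1 <= t k / 3.
  move=> kN; rewrite -[t k / 3]invrK lef_pV2 ?posrE ?invr_gt0 ?divr_gt0//.
  rewrite invf_div; apply: le_trans _ Qq.
  rewrite (bigD1 (Ordinal kN))//= lerDl sumr_ge0// => j _.
  by rewrite divr_ge0// ltW.
have s0 k : (0 <= (\prod_(i < d) (b k 0 i - a k 0 i))%:E)%E.
  by rewrite lee_fin prodr_ge0.
apply: le_trans (epsilon_trick xpredT s0 (ltW eta0)).
apply: le_trans (nneseries_lim_ge N _); last first.
  by move=> k _ _; apply: adde_ge0 => //; rewrite lee_fin divr_ge0// ltW.
under eq_bigr do rewrite -EFinD.
rewrite sumEFin lee_fin big_mkord.
apply: (@le_trans _ _ (\sum_(k < N) (gridcount q (U k))%:R / q%:R ^+ d)).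
  rewrite -mulr_suml ler_pM2r ?invr_gt0 ?exprn_gt0// -natr_sum ler_nat.
  pose V k : {set {ffun 'I_d -> 'I_q.+1}} := [set z | `[< U k (gridpt R z) >]]%SET.
  have h1 : (gridcount q A <= #|(\bigcup_(k < N) V k)%SET|)%N.
    apply: subset_leq_card; apply/fintype.subsetP => z /asboolP /AD[k /= kD Ukz].
    by apply/finset.bigcupP; exists (Ordinal (DN _ kD)) => //; rewrite inE; apply/asboolP.
  apply: leq_trans h1 _.
  elim/big_ind2 : _ => //; first by rewrite cards0.
    move=> X x Y y hX hY; apply: leq_trans (leq_add hX hY).
    by rewrite -cardsUI leq_addr.
  by move=> k _; rewrite cardsE.
apply: ler_sum => k _.
have [_ ] := ht k; apply: le_trans.
apply: (@le_trans _ _ (\prod_(i < d) (b k 0 i + t k / 3 - (a k 0 i - t k / 3) + q%:R^-1))).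
  apply: le_trans (gridcount_box q0 _).
    rewrite ler_pM2r ?invr_gt0 ?exprn_gt0// ler_nat; apply: subset_leq_card.
    apply/fintype.subsetP => z /asboolP hz; apply/asboolP => i.
    by have /andP[h1 h2] := hz i; rewrite !ltW.
  by move=> i; have := l0 k i; have := t0 k; lra.
apply: ler_prod => i _; have := qt k (ltn_ord k); have := l0 k i; have := t0 k.
have : 0 < q%:R^-1 :> R by rewrite invr_gt0.
by move=> *; apply/andP; split; lra.
Qed.

(** Cover [B] by cubes of side 1/q with lower corners on the grid: rounding a point of [B] down
    moves each coordinate by at most 1/q, so the corner lies in the thickening by r + 1/q. *)
Lemma vol_le_gridcount (d q : nat) (A B : set 'rV[RR]_d) (r : RR) :
  (0 < d)%N -> (0 < q)%N -> 0 <= r ->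
  (forall x i, B x -> 0 <= x 0 i <= 1) -> B `<=` thicken A r d ->
  (vol B <= ((gridcount q (thicken A (r + q%:R^-1) d))%:R / q%:R ^+ d)%:E)%E.
Proof.
move=> d0 q0 r0 B01 BA; have q0R : 0 < q%:R :> RR by rewrite ltr0n.
pose P := [pred z : {ffun 'I_d -> 'I_q.+1} |
  `[< thicken A (r + q%:R^-1) d (gridpt RR z) >]].
pose s := enum P; pose z0 : {ffun 'I_d -> 'I_q.+1} := [ffun=> ord0].
(* After the finitely many cubes, the sequence continues with the one-point box at 0, of volume 0
   because d > 0. *)
pose a k : 'rV[RR]_d := if (k < #|P|)%N then gridpt RR (nth z0 s k) else 0.
pose b k : 'rV[RR]_d := if (k < #|P|)%N then a k + const_mx q%:R^-1 else 0.
have pE k : \prod_(i < d) (b k 0 i - a k 0 i) =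
    if (k < #|P|)%N then q%:R ^- d else 0.
  rewrite /b /a; case: ifP => hk.
    rewrite -exprVn -[in RHS](card_ord d) -prodr_const; apply: eq_bigr => i _.
    by rewrite hk !mxE addrAC subrr add0r.
  by case: d d0 {hk B01 BA P s z0 a b B A} => // d _; rewrite big_ord_recl subrr mul0r.
apply: ereal_inf_lbound; exists a, b; split.
- move=> k i; rewrite /b; case: ifP => h; last by rewrite /a h.
  by rewrite !mxE lerDl invr_ge0 ltW.
- move=> x Bx.
  (* The coordinate value 1 rounds to index q, hence q+1 grid values per axis. *)
  have trl (i : 'I_d) : (Num.truncn (x 0%R i * q%:R)%R < q.+1)%N.
    have /andP[x0 x1] := B01 x i Bx.
    have := truncn_le (x 0 i * q%:R); rewrite mulr_ge0// ltnS -(ler_nat RR).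
    by move/le_trans; apply; rewrite ler_piMl.
  pose z : {ffun 'I_d -> 'I_q.+1} := [ffun i => Ordinal (trl i)].
  have hz (i : 'I_d) : gridpt RR z 0 i <= x 0 i <= gridpt RR z 0 i + q%:R^-1.
    have /andP[x0 x1] := B01 x i Bx.
    rewrite mxE ffunE /= ler_pdivrMr// -[X in _ + X]mul1r -mulrDl natr1 ler_pdivlMr//.
    have := truncn_itv (x := x 0 i * q%:R); rewrite mulr_ge0// => /(_ isT)/andP[-> h].
    exact: ltW.
  have Pz : z \in s.
    rewrite mem_enum; apply/asboolP; have [y Ay hy] := BA _ Bx.
    exists y => // i; have := hy i; rewrite ltn_ord => h.
    have -> : gridpt RR z 0 i - y 0 i =
       (gridpt RR z 0 i - x 0 i) + (x 0 i - y 0 i) by rewrite addrA subrK.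
    apply: le_trans (ler_normD _ _) _; rewrite addrC lerD//.
    have /andP[h1 h2] := hz i.
    by rewrite distrC ger0_norm ?subr_ge0// lerBlDl.
  have iz : (index z s < #|P|)%N by rewrite cardE index_mem.
  exists (index z s) => // i; rewrite /b /a iz nth_index//.
  have -> : (gridpt RR z + const_mx q%:R^-1) 0 i = gridpt RR z 0 i + q%:R^-1.
    by rewrite !mxE.
  exact: hz.
under eq_eseriesr do rewrite pE.
rewrite (nneseries_split 0 #|P|); last first.
  by move=> k _; case: ifP => _//; rewrite lee_fin invr_ge0 exprn_ge0// ltW.
rewrite add0n eseries0 ?adde0; last first.
  by move=> i Pi _; rewrite ltnNge Pi.
rewrite sumEFin big_mkord; congr EFin.
under eq_bigr do rewrite ltn_ord.
by rewrite sumr_const card_ord -[RHS]mulr_natl.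
Qed.

Lemma vol_ge0 (d : nat) (A : set 'rV[RR]_d) : (0 <= vol A)%E.
Proof.
apply: le_ereal_inf_tmp => _ [a [b [ab _ ->]]]; apply: nneseries_ge0 => k _ _.
by rewrite lee_fin prodr_ge0// => i _; rewrite subr_ge0.
Qed.

Lemma le_vol (d : nat) (A B : set 'rV[RR]_d) : A `<=` B -> (vol A <= vol B)%E.
Proof.
move=> AB; apply: le_ereal_inf_tmp => _ [a [b [ab Bc ->]]]; apply: ereal_inf_lbound.
by exists a, b; split => //; exact: subset_trans Bc.
Qed.

(** For any box cover of [A], a fine grid gives vol B <= grid count of the thickening <= grid count
    of A + C (r + 2/q) <= volume of the cover + C r + eta. *)
Lemma vol_le_thicken (d : nat) (A B : set 'rV[RR]_d) (r : RR) :
  (0 < d)%N -> 0 <= r -> convex_rv A -> compact A ->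
  (forall x i, B x -> 0 <= x 0 i <= 1) -> B `<=` thicken A r d ->
  (vol B <= vol A + ((d * 2 ^ d.+1)%:R * r)%:E)%E.
Proof.
move=> d0 r0 cA kA B01 BA; rewrite -leeBlDr//.
apply: le_ereal_inf_tmp => _ [a [b [ab Acov ->]]]; rewrite leeBlDr//.
apply/lee_addgt0Pr => eta eta0.
have eta2 : 0 < eta / 2 by rewrite divr_gt0.
have [Q HQ] := compact_cover_gridcount ab kA Acov eta2.
set C : RR := (d * 2 ^ d.+1)%:R in HQ *.
have C0 : 0 <= C by [].
(* The bound by [Q] makes the count of [A] accurate up to eta/2. The bound by 4C/eta controls C
   (2/q): one 1/q comes from rounding, the other from [gridcount_thicken]. *)
pose q := (Num.truncn (Num.max Q (4 * C / eta))).+1.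
have qQ : Num.max Q (4 * C / eta) <= q%:R by apply/ltW/truncnS_gt.
have q0R : 0 < q%:R :> RR by rewrite ltr0n.
have qC : C * (q%:R^-1 + q%:R^-1) <= eta / 2.
  have : 4 * C / eta <= q%:R by apply: le_trans qQ; rewrite le_max lexx orbT.
  rewrite ler_pdivrMr// => h.
  have -> : C * (q%:R^-1 + q%:R^-1) = (2 * C) / q%:R by lra.
  by rewrite ler_pdivrMr//; lra.
apply: le_trans (vol_le_gridcount (q := q) d0 _ r0 B01 BA) _ => //.
have rq : 0 <= r + q%:R^-1 by rewrite addr_ge0// invr_ge0 ltW.
have := gridcount_thicken (q := q) isT rq cA; rewrite -lee_fin => /le_trans; apply.
rewrite EFinD; apply: le_trans (leeD (HQ q _ _) (lexx _)) _ => //.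
  by apply: le_trans qQ; rewrite le_max lexx.
rewrite -addeA -[in leRHS]addeA; apply: leeD => //.
by rewrite -!EFinD lee_fin -/C; lra.
Qed.

Lemma vol_unit_cube (d : nat) (A : set 'rV[RR]_d) : (0 < d)%N ->
  (forall x i, A x -> 0 <= x 0 i <= 1) -> (vol A <= 1)%E.
Proof.
move=> d0 A01; apply: ereal_inf_lbound; exists (fun=> 0),
  (fun k => if k == 0%N then const_mx 1 else 0); split.
- by move=> k i; case: ifP => _; rewrite ?mxE.
- by move=> x Ax; exists 0%N => // i /=; rewrite !mxE; exact: A01.
rewrite (nneseries_split 0 1); last first.
  move=> k _; rewrite lee_fin prodr_ge0// => i _; rewrite subr_ge0.
  by case: ifP => _; rewrite ?mxE.
rewrite eseries0 ?adde0; last first.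
  move=> [//|k] _ _ /=.
  by case: d d0 {A01 A} => // d _; rewrite big_ord_recl subrr mul0r.
rewrite big_nat1 /= big1// => i _.
by rewrite !mxE subr0.
Qed.

(** * Convex hulls of finite families *)

Definition simplex_hull (R : realType) (d : nat) (I : finType) (q : I -> 'rV[R]_d)
    : set 'rV[R]_d :=
  [set x | exists w : I -> R,
    [/\ forall i, 0 <= w i, \sum_i w i = 1 & x = \sum_i w i *: q i]].

Lemma simplex_hull_convex (R : realType) (d : nat) (I : finType) (q : I -> 'rV[R]_d) :
  convex_rv (simplex_hull q).
Proof.
move=> _ _ t [w [w0 w1 ->]] [v [v0 v1 ->]] /andP[t0 t1].
exists (fun i => t * w i + (1 - t) * v i); split.
- by move=> i; rewrite addr_ge0 ?mulr_ge0 ?subr_ge0.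
- by rewrite big_split /= -!mulr_sumr w1 v1 !mulr1 addrC subrK.
- rewrite !scaler_sumr -big_split /=; apply: eq_bigr => i _.
  by rewrite [RHS]scalerDl !scalerA.
Qed.

(** With a fixed finite family of generators the hull is a continuous image of the standard simplex,
    a closed subset of a cube. *)
Lemma simplex_hull_compact (R : realType) (d : nat) (I : finType) (q : I -> 'rV[R]_d) :
  compact (simplex_hull q).
Proof.
pose f (v : 'rV[R]_#|I|) := \sum_i v 0 (enum_rank i) *: q i.
pose S := [set v : 'rV[R]_#|I| | forall i, `[(0:R), 1] (v ord0 i)] `&`
          [set v : 'rV[R]_#|I| | \sum_i v 0 i = 1].
have -> : simplex_hull q = f @` S.
  apply/seteqP; split => x.
    move=> [w [w0 w1 ->]]; exists (\row_j w (@enum_val I predT j)); last first.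
      by apply: eq_bigr => i _; rewrite mxE enum_rankK.
    have sw : \sum_j w (@enum_val I predT j) = 1.
      rewrite -w1; apply/esym; rewrite (reindex (@enum_val I predT)) //=.
      exact/onW_bij/enum_val_bij.
    split=> /=; last by under eq_bigr do rewrite mxE.
    move=> j; rewrite mxE in_itv /= w0 /= -sw (bigD1 j)//= lerDl.
    by apply: sumr_ge0.
  move=> [v [v01 /= vs] <-]; exists (fun i => v 0 (enum_rank i)); split => //.
    by move=> i; have := v01 (enum_rank i); rewrite /= in_itv /= => /andP[].
  rewrite -vs; apply/esym; rewrite (reindex (@enum_rank I)) //=; exact/onW_bij/enum_rank_bij.
apply: continuous_compact.
  apply: continuous_subspaceT; rewrite /f.
  apply: continuous_big => [|i _ v]; first exact: add_continuous.
  have h := (@coord_continuous R 1 #|I| 0 (enum_rank i) v).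
  by move: h; apply: cvgZr_tmp; exact: nbhs_filter.
rewrite /S; apply: (@compact_closedI 'rV[R]_#|I|).
  by apply: (@rV_compact R #|I| (fun=> `[(0:R), 1]%classic)) => i; exact: segment_compact.
apply: (proj1 (continuous_closedP (fun v : 'rV[R]_#|I| => \sum_i v 0 i)) _ [set x : R | x = 1]).
  apply: continuous_big => [|i _]; first exact: add_continuous.
  exact: (@coord_continuous R 1 #|I| 0 i).
exact: closed_eq.
Qed.

Lemma chull_sub_simplex_hull (d : nat) (I : finType) (q : I -> 'rV[RR]_d)
    (A : set 'rV[RR]_d) : A `<=` simplex_hull q -> chull A `<=` simplex_hull q.
Proof.
move=> Aq _ [m [w [p [w0 w1 pA ->]]]].
have /choice[v hv] i := Aq _ (pA i).
exists (fun j => \sum_(i < m) w i * v i j); split.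
- by move=> j; apply: sumr_ge0 => i _; rewrite mulr_ge0//; have [] := hv i.
- rewrite exchange_big /= -w1; apply: eq_bigr => i _.
  by rewrite -mulr_sumr; have [_ -> _] := hv i; rewrite mulr1.
- under [RHS]eq_bigr do rewrite scaler_suml.
  rewrite exchange_big /=; apply: eq_bigr => i _.
  have [_ _ ->] := hv i; rewrite scaler_sumr; apply: eq_bigr => j _.
  by rewrite scalerA.
Qed.

Lemma simplex_hull_sub_chull (d : nat) (I : finType) (q : I -> 'rV[RR]_d)
    (A : set 'rV[RR]_d) : (forall i, A (q i)) -> simplex_hull q `<=` chull A.
Proof.
move=> qA _ [w [w0 w1 ->]].
exists #|I|, (fun j => w (@enum_val I predT j)), (fun j => q (@enum_val I predT j)); split => //.
  by rewrite -w1; apply/esym; rewrite (reindex (@enum_val I predT)) //=; exact/onW_bij/enum_val_bij.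
by rewrite (reindex (@enum_val I predT)) //=; exact/onW_bij/enum_val_bij.
Qed.

(** * Comparison of the two bodies *)

Lemma tdens01 (F : sgraph) (N : nat) (adj : rel 'I_N) : symmetric adj ->
  0 <= tdens F adj <= 1.
Proof.
move=> asym; case: (leqP (sg_n F) N) => [FN|NF]; last first.
  by rewrite /tdens leqNgt NF lexx ler01.
rewrite tdensE// divr_ge0//= ler_pdivrMr ?ltr0n ?card_injectiveb_gt0//.
rewrite mul1r ler_nat; apply: subset_leq_card.
by apply/fintype.subsetP => g /andP[].
Qed.

Section polytopes.
Variables (d : nat) (Fs : 'I_d -> sgraph).

(** By [avg_tdens_sample], a point of the curvy zonotope is the expected density vector of the
    N-vertex random graph, hence a convex combination of density vectors. *)
Lemma Zcurvy_sub_Pinf (n : nat) : (0 < n)%N -> chull (Zcurvy Fs n) `<=` Pinf Fs.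
Proof.
move=> n0 x Zx N /= FsN.
have FN i : (sg_n (Fs i) <= N)%N by apply: leq_trans FsN; exact: leq_bigmax.
(* The index also records the vertex sample psi, so that the weight of [u] is a joint
   probability. *)
pose q (u : {ffun 'I_N -> 'I_n} * {ffun 'I_N * 'I_N -> bool}) := tvec Fs (graph_rel u.2).
apply: (@simplex_hull_sub_chull _ _ q).
  move=> [psi G]; exists (graph_rel G) => //=.
  by split; [exact: graph_rel_sym|exact: graph_rel_irr].
move: x Zx; apply: chull_sub_simplex_hull => _ [x [xT x01] <-].
have T0 : (0 < #|'I_n|)%N by rewrite card_ord.
have P0 : (0 < #|{ffun 'I_N -> 'I_n}|)%N by rewrite card_ffun expn_gt0 T0.
have xsym i j : x i j = x j i by rewrite -[in LHS]xT mxE.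
pose W (psi : {ffun 'I_N -> 'I_n}) := graph_weight (fun i j => x (psi i) (psi j)).
exists (fun u => W u.1 u.2 / #|{ffun 'I_N -> 'I_n}|%:R); split.
- by move=> u; rewrite divr_ge0// graph_weight_ge0.
- rewrite -(pair_bigA _ (fun psi G => W psi G / #|{ffun 'I_N -> 'I_n}|%:R)) /=.
  under eq_bigr do rewrite -mulr_suml sum_graph_weight.
  by rewrite -mulr_suml; exact: avg_cst.
apply/rowP => k; rewrite mxE summxE pFE.
rewrite -(pair_bigA _ (fun psi G =>
  (W psi G / #|{ffun 'I_N -> 'I_n}|%:R *: tvec Fs (graph_rel G)) 0 k)) /=.
rewrite -(avg_tdens_sample T0 (FN k) xsym) /avg mulr_suml.
apply: eq_bigr => psi _; rewrite mulr_suml; apply: eq_bigr => G _.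
by rewrite !mxE mulrAC.
Qed.

(* Symmetrised, so that the index set of [bool_hull] can be all boolean matrices. *)
Definition bool_step (n : nat) (B : 'M[bool]_n) : 'M[RR]_n :=
  \matrix_(i, j) (B i j || B j i)%:R.

Definition bool_hull (n : nat) : set 'rV[RR]_d :=
  simplex_hull (fun B : 'M[bool]_n => \row_i pF (Fs i) (bool_step B)).

Lemma bool_hull_sub (n : nat) : bool_hull n `<=` chull (Zcurvy Fs n).
Proof.
apply: simplex_hull_sub_chull => B; exists (bool_step B) => //=; split.
  by apply/matrixP => i j; rewrite !mxE orbC.
by move=> i j; rewrite mxE; case: (_ || _); rewrite ?lexx ?ler01.
Qed.

(** For a graph on N vertices, the mean over psi of the vectors of its pullbacks lies in
    [bool_hull], at distance at most [r] by [dist_avg_hom_weight_sample] and [dist_tdens_avg];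
    convex combinations preserve the bound. *)
Lemma Ppoly_sub_thicken (e n N : nat) (r : RR) :
  (0 < n)%N -> (0 < N)%N -> (forall i, (sg_n (Fs i) <= N)%N) ->
  (forall i, (nedges (Fs i) <= e)%N) ->
  (forall i, ((2 * e) ^ 2)%:R / n%:R + (sg_n (Fs i) ^ 2)%:R / N%:R <= r) ->
  Ppoly Fs N `<=` thicken (bool_hull n) r d.
Proof.
move=> n0 N0 FN Fe hr _ [m [w [p [w0 w1 pP ->]]]].
have /choice[y hy] i : exists y, bool_hull n y /\ forall k, `|p i 0 k - y 0 k| <= r.
  have [adj [asym airr] <-] := pP i.
  pose x (a b : 'I_N) : RR := (adj a b)%:R.
  pose S := {ffun 'I_n -> 'I_N}.
  have S0 : (0 < #|{: S}|)%N by rewrite card_ffun !card_ord expn_gt0 N0.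
  pose B (psi : S) : 'M[bool]_n := \matrix_(i, j) adj (psi i) (psi j).
  exists (\sum_(psi : S) #|{: S}|%:R^-1 *: \row_k pF (Fs k) (bool_step (B psi))).
  split.
    (* Different psi may pull back to the same matrix, so their weights are collected by matrix. *)
    exists (fun C => \sum_(psi : S | B psi == C) #|{: S}|%:R^-1); split.
    - by move=> C; apply: sumr_ge0 => psi _; rewrite invr_ge0.
    - transitivity (\sum_(psi : S) (#|{: S}|%:R^-1 : RR)).
        by rewrite [RHS](partition_big B predT).
      by rewrite sumr_const -[LHS]mulr_natl divff// pnatr_eq0 -lt0n.
    rewrite (partition_big B predT) //=; apply: eq_bigr => C _.
    by rewrite scaler_suml; apply: eq_bigr => psi /eqP ->.
  move=> k; rewrite mxE summxE.
  have -> : \sum_(psi : S) (#|{: S}|%:R^-1 *: \row_k pF (Fs k) (bool_step (B psi))) 0 k =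
      avg (fun psi : S => avg (hom_weight (Fs k) (fun i j => x (psi i) (psi j)))).
    rewrite [RHS]mulr_suml; apply: eq_bigr => psi _; rewrite !mxE mulrC; congr (_ * _).
    rewrite pFE; congr (_ / _); apply: eq_bigr => phi _; apply: eq_bigr => ed _.
    by rewrite !mxE [adj (psi (phi ed.2)) _]asym orbb.
  have x01 a b : 0 <= x a b <= 1 by rewrite /x; case: (adj a b); rewrite ?lexx ?ler01.
  have D1 := dist_tdens_avg asym N0 (FN k).
  have := @dist_avg_hom_weight_sample _ (Fs k) 'I_n 'I_N x.
  rewrite !card_ord => /(_ N0 n0 x01) D2.
  apply: le_trans _ (hr k); rewrite -[X in `|X - _|](subrK (avg (hom_weight (Fs k) x))) -addrA.
  apply: le_trans (ler_normD _ _) _; rewrite [leRHS]addrC; apply: lerD => //.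
  apply: le_trans D2 _; rewrite ler_pM2r ?invr_gt0 ?ltr0n// ler_nat.
  by rewrite leq_exp2r// leq_mul2l Fe.
exists (\sum_(i < m) w i *: y i).
  apply: (@chull_sub_simplex_hull _ _ _ (bool_hull n)) => //.
  by exists m, w, y; split => // i; have [] := hy i.
move=> k; rewrite ltn_ord !summxE -sumrB; apply: le_trans (ler_norm_sum _ _ _) _.
rewrite -[r]mul1r -w1 mulr_suml; apply: ler_sum => i _.
rewrite !mxE -mulrBr normrM ger0_norm//; apply: ler_wpM2l => //.
by have [_ ] := hy i; exact.
Qed.

Lemma Pinf_sub_Ppoly (N : nat) : (forall i, (sg_n (Fs i) <= N)%N) ->
  Pinf Fs `<=` Ppoly Fs N.
Proof. by move=> FN x; apply => /=; apply/bigmax_leqP => i _. Qed.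

Lemma Pinf01 x i : Pinf Fs x -> 0 <= x 0 i <= 1.
Proof.
move=> /(Pinf_sub_Ppoly (N := \max_(i < d) sg_n (Fs i))) [|m [w [p [w0 w1 pP ->]]]].
  by move=> k; exact: leq_bigmax.
rewrite summxE.
have p01 k : 0 <= p k 0 i <= 1.
  by have [adj [asym _] <-] := pP k; rewrite mxE tdens01.
apply/andP; split.
  by apply: sumr_ge0 => k _; rewrite mxE mulr_ge0//; case/andP: (p01 k).
rewrite -w1; apply: ler_sum => k _; rewrite mxE ler_piMr//.
by case/andP: (p01 k).
Qed.

Lemma Pinf_sub_thicken (e n : nat) (r : RR) : (0 < n)%N ->
  (forall i, (nedges (Fs i) <= e)%N) -> ((2 * e) ^ 2)%:R / n%:R < r ->
  Pinf Fs `<=` thicken (bool_hull n) r d.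
Proof.
move=> n0 Fe hr; set s : RR := _ / _ in hr.
pose K := \max_(i < d) sg_n (Fs i).
(* As [Pinf] lies in every P_N with N >= K, take N so large that the collision error K^2 / N fits in
   the slack r - s. *)
pose N := (K + (Num.truncn ((K ^ 2)%:R / (r - s))).+1)%N.
have FK i : (sg_n (Fs i) <= K)%N by exact: leq_bigmax.
have FN i : (sg_n (Fs i) <= N)%N by exact: leq_trans (FK i) (leq_addr _ _).
have N0 : (0 < N)%N by rewrite /N addnS.
have rs : 0 < r - s by rewrite subr_gt0.
apply: subset_trans (Pinf_sub_Ppoly FN) (Ppoly_sub_thicken n0 N0 FN Fe _) => i.
rewrite -/s -lerBrDl ler_pdivrMr ?ltr0n// mulrC -ler_pdivrMr//.
apply: (@le_trans _ _ ((K ^ 2)%:R / (r - s))).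
  by rewrite ler_pM2r ?invr_gt0// ler_nat leq_exp2r// FK.
by apply: le_trans (ltW (truncnS_gt _)) _; rewrite ler_nat /N leq_addl.
Qed.

End polytopes.

(** * Choice of the constants and conclusion *)

Lemma powR2_ge1D (x : RR) : 1 + x * ln 2 <= 2 `^ x.
Proof. by rewrite /powR pnatr_eq0 /=; exact: expR_ge1Dx. Qed.

Theorem theorem5p7 :
  forall d : nat, (0 < d)%N ->
  exists kd : RR,
  forall (Fs : 'I_d -> sgraph) (e : nat),
    (forall i, (nedges (Fs i) <= e)%N) ->
  forall (eps : RR) (n : nat), 0 < eps ->
    (2 : RR) `^ (kd * (d ^ 2 * e ^ 2)%:R / eps ^+ 2) < n%:R ->
    (0 <= vol (Pinf Fs) - vol (chull (Zcurvy Fs n)))%E /\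
    (vol (Pinf Fs) - vol (chull (Zcurvy Fs n)) < eps%:E)%E.
Proof.
move=> d d0; pose C : RR := (d * 2 ^ d.+1)%:R.
have C0 : 0 < C by rewrite ltr0n muln_gt0 d0 expn_gt0.
have ln20 : 0 < ln 2 :> RR by rewrite ln_gt0// ltr1n.
(* The factor 4 comes from (2e)^2, [C] from [vol_le_thicken], and ln 2 cancels the one in
   [powR2_ge1D]. *)
exists (4 * C / ln 2) => Fs e Fe eps n eps0 hn.
have n0 : (0 < n)%N by rewrite -(ltr0n RR); apply: le_lt_trans hn; exact: powR_ge0.
have ZP := Zcurvy_sub_Pinf (Fs := Fs) n0.
have P01 : (vol (Pinf Fs) <= 1)%E by apply: vol_unit_cube => // x i; exact: Pinf01.
have Pfin : vol (Pinf Fs) \is a fin_num.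
  by rewrite ge0_fin_numE ?vol_ge0// (le_lt_trans P01)// ltry.
have Zfin : vol (chull (Zcurvy Fs n)) \is a fin_num.
  by rewrite ge0_fin_numE ?vol_ge0// (le_lt_trans (le_vol ZP))// (le_lt_trans P01)// ltry.
split; first by rewrite sube_ge0 ?Zfin// le_vol.
(* For eps > 1 the bound is immediate from vol(Pinf) <= 1; below, eps <= 1 is used to compare powers
   of eps. *)
have [eps1|eps1] := ltP 1 eps.
  apply: (@le_lt_trans _ _ (vol (Pinf Fs))); first by rewrite geeDl// oppe_le0 vol_ge0.
  by apply: le_lt_trans P01 _; rewrite lte_fin.
(* The hypothesis yields n - 1 >= 4 C d^2 e^2 / eps^2, so eps (n - 1) >= 4 C e^2 as d >= 1 and eps
   <= 1. Passing from n - 1 to n gives strictness, also for e = 0. *)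
have small : C * (((2 * e) ^ 2)%:R / n%:R) < eps.
  have n0R : 0 < n%:R :> RR by rewrite ltr0n.
  have de : (e ^ 2)%:R <= (d ^ 2 * e ^ 2)%:R :> RR.
    by rewrite ler_nat leq_pmull// expn_gt0 d0.
  rewrite mulrA ltr_pdivrMr//; apply: le_lt_trans _ (_ : eps * (n%:R - 1) < _); last first.
    by rewrite ltr_pM2l// ltrBlDr ltrDl.
  have : 4 * C * (d ^ 2 * e ^ 2)%:R / eps ^+ 2 <= n%:R - 1.
    rewrite lerBrDl; apply: le_trans (ltW hn); apply: le_trans (powR2_ge1D _).
    rewrite lerD2l [leRHS]mulrAC [_ / ln 2 * _]mulrAC divfK// gt_eqF//.
  rewrite -(ler_pM2l eps0); apply: le_trans.
  have -> : eps * (4 * C * (d ^ 2 * e ^ 2)%:R / eps ^+ 2) =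
      4 * C * (d ^ 2 * e ^ 2)%:R / eps.
    by rewrite expr2 invfM mulrCA mulVKf// gt_eqF.
  rewrite ler_pdivlMr// expnMn natrM [4 * C]mulrC -!mulrA !ler_pM2l//.
  by apply: le_trans de; rewrite ler_piMr.
(* The midpoint satisfies both strict requirements: r > (2e)^2 / n for [Pinf_sub_thicken], and C r <
   eps at the end. *)
pose r := (((2 * e) ^ 2)%:R / n%:R + eps / C) / 2.
have hs : ((2 * e) ^ 2)%:R / n%:R < eps / C by rewrite ltr_pdivlMr// mulrC.
have r1 : ((2 * e) ^ 2)%:R / n%:R < r by exact: (midf_lt hs).1.
have r2 : r < eps / C by exact: (midf_lt hs).2.
have r0 : 0 <= r by apply: le_trans (ltW r1); rewrite divr_ge0.
rewrite lteBlDl//.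
(* The thickening bound is applied to [bool_hull], which is compact as the hull of a finite family,
   and monotonicity of [vol] then passes to the hull of the zonotope. *)
apply: (@le_lt_trans _ _ (vol (bool_hull Fs n) + (C * r)%:E)%E).
  apply: vol_le_thicken => //.
  - exact: simplex_hull_convex.
  - exact: simplex_hull_compact.
  - by move=> x i; exact: Pinf01.
  - exact: Pinf_sub_thicken r1.
apply: (@le_lt_trans _ _ (vol (chull (Zcurvy Fs n)) + (C * r)%:E)%E).
  by rewrite leeD2r// le_vol//; exact: bool_hull_sub.
by rewrite lteD2lE// lte_fin mulrC -ltr_pdivlMr.
Qed.
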